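(* Let $m$ be odd, $1\le m\le n$, and let $L=A_1A_3\dots A_{2n-1}$ be a real $m$-self-dual $n$-gon in $\mathbb{RP}^2$. Then, of the $2^{2n}$ polygonal curves arising from the polygon $L$, exactly $2^{(m,n)}$ are $m$-self-dual, where $(m,n)$ is the greatest common divisor of $m$ and $n$.
   Context: $V=\mathbb R^3$, $P=\mathbb{RP}^2$ is its projectivization, $P^*$ is the projectivization of $V^*$. For a point or line $X$ of $P$, $X^*$ denotes its annihilator in $V^*$ (a line or a point of $P^*$). An $n$-gon in $P$ is a cyclically ordered collection of vertices $A_1,A_3,\dots,A_{2n-1}\in P$ (indices are odd residues modulo $2n$) and sides $B_{2i}=A_{2i-1}A_{2i+1}$ (indices are even residues modulo $2n$). Polygons are non-degenerate: no three consecutive vertices are collinear. The $n$-gon is $m$-self-dual if there is a projective isomorphism $\hat f\colon P\to P^*$ with $\hat f(A_i)=B_{i+m}^*$ for all $i$. Standing convention: for the given $m$-self-dual polygon this $\hat f$ is unique. A polygonal curve is a real polygon $A_1A_3\dots A_{2n-1}$ with two independent additional structures: (1) for every even $i$, one of the two segments into which the points $A_{i-1},A_{i+1}$ cut the real projective line $B_i$ is chosen (called an edge); (2) for every odd $i$, one of the two pairs of vertical angles formed by the lines $B_{i-1},B_{i+1}$ at $A_i$ is chosen (called exterior angles). Thus every real $n$-gon gives rise to $2^{2n}$ polygonal curves. The dual polygonal curve is the polygon $B_2^*B_4^*\dots B_{2n}^*$ in $P^*$ with the following edges and exterior angles: the edge $B_{2i}^*B_{2i+2}^*$ consists of the points of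 $P^*$ dual to the lines through $A_{2i+1}$ contained in the exterior angles at $A_{2i+1}$; the exterior angles at $B_{2i}^*$ are formed by the lines in $P^*$ dual to the points of the edge $A_{2i-1}A_{2i+1}$. A polygonal curve is $m$-self-dual if there is a projective isomorphism $P\to P^*$ which takes $A_i$ to $B_{i+m}^*$ for all $i$ and takes the edges and exterior angles of the polygonal curve $A_1A_3\dots A_{2n-1}$ to the edges and exterior angles of the dual polygonal curve. *)

(* Defs.v *)
From HB Require Import structures.
From mathcomp Require Import all_boot all_order all_algebra.
From mathcomp Require Import all_classical reals.

Set Implicit Arguments.
Unset Strict Implicit.
Unset Printing Implicit Defensive.

Import Order.TTheory GRing.Theory Num.Theory.
Local Open Scope classical_set_scope.
Local Open Scope ring_scope.

Definition projsp (K : fieldType) (W : vectType K) : Type :=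
  {U : {vspace W} | \dim U == 1%N}.

Definition dualsp (K : fieldType) (W : vectType K) : vectType K :=
  'Hom(W, K^o).

(** [phi] vanishes on [U] iff [phi \o projv U = 0]; see [mem_annv] below. *)
Definition annv (K : fieldType) (W : vectType K) (U : {vspace W}) :
    {vspace dualsp W} :=
  lker (linfun (fun phi : 'Hom(W, K^o) => (phi \o projv U)%VF)).

Lemma mem_annv (K : fieldType) (W : vectType K) (U : {vspace W})
    (phi : 'Hom(W, K^o)) :
  reflect (forall x, x \in U -> phi x = 0) (phi \in annv U).
Proof.
have lin : linear (fun phi : 'Hom(W, K^o) => (phi \o projv U)%VF).
  by move=> a f g; apply/lfunP => x; rewrite !lfunE /= !lfunE /= !lfunE.
pose h := HB.pack_for {linear 'Hom(W, K^o) -> 'Hom(W, K^o)}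
  (fun phi : 'Hom(W, K^o) => (phi \o projv U)%VF)
  (GRing.isLinear.Build _ _ _ _ _ lin).
have E : linfun (fun phi : 'Hom(W, K^o) => (phi \o projv U)%VF) phi
         = (phi \o projv U)%VF by exact: (lfunE h phi).
rewrite memv_ker E; apply: (iffP eqP) => [E0 x Ux | phi0].
  by move/lfunP: E0 => /(_ x); rewrite !lfunE /= projv_id.
by apply/lfunP => x; rewrite !lfunE /= phi0 ?memv_proj.
Qed.

Definition proj_iso (K : fieldType) (W W' : vectType K)
    (f : projsp W -> projsp W') : Prop :=
  exists2 F : 'Hom(W, W'),
    lker F == 0%VS /\ limg F == fullv & forall p, val (f p) = (F @: val p)%VS.

Definition collinear (K : fieldType) (W : vectType K) (p q r : projsp W) : Prop :=
  exists l : {vspace W}, \dim l = 2%N /\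
    [/\ (val p <= l)%VS, (val q <= l)%VS & (val r <= l)%VS].

(** [S] is one of the two (closed) segments into which the points [p] and [q]
    cut the line [pq]; replacing [b] by [- b] gives the other one.  Since [val r]
    is one-dimensional, [s] and [t] cannot both vanish. *)
Definition is_segment (R : realType) (W : vectType R) (p q : projsp W)
    (S : set (projsp W)) : Prop :=
  exists a b : W, [/\ val p = <[a]>%VS, val q = <[b]>%VS &
    S = [set r : projsp W | exists s t : R,
           [/\ 0 <= s, 0 <= t & val r = <[s *: a + t *: b]>%VS]]].

(** [S] is one of the two (closed) pairs of vertical angles formed by the lines
    [k] and [l], seen as a region of the projective plane; replacing [psi] by
    [- psi] gives the other one. *)
Definition is_vertical_angles (R : realType) (W : vectType R)
    (k l : {vspace W}) (S : set (projsp W)) : Prop :=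
  exists phi psi : 'Hom(W, R^o), [/\ lker phi = k, lker psi = l &
    S = [set r : projsp W | forall x, x \in val r -> 0 <= phi x * psi x :> R]].

(** Indices are residues modulo [2n].  A polygon is given by
    [A : 'Z_(n.*2) -> projsp V], of which only the values at odd residues (the
    vertices) are ever used. *)

Section Polygon.
Variables (R : realType) (n : nat).
Notation V := 'rV[R]_3.
Implicit Types (A : 'Z_(n.*2) -> projsp V) (C : 'Z_(n.*2) -> set (projsp V)).

(** The side [B_i]; meaningful for [i] even. *)
Definition side A (i : 'Z_(n.*2)) : {vspace V} :=
  (val (A (i - 1)%R) + val (A (i + 1)%R))%VS.

Definition nondegenerate_polygon A : Prop :=
  forall i : 'Z_(n.*2), odd i -> ~ collinear (A (i - 2%:R)) (A i) (A (i + 2%:R)).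

Definition self_duality (m : nat) A (f : projsp V -> projsp (dualsp V)) : Prop :=
  proj_iso f /\
  forall i : 'Z_(n.*2), odd i -> val (f (A i)) = annv (side A (i + m%:R)).

Definition polygon_self_dual (m : nat) A : Prop := exists f, self_duality m A f.

(** Both kinds of additional structure are subsets of the plane, hence are
    recorded by a single function [C]: for [i] even [C i] is the edge on [B_i],
    for [i] odd [C i] is the union of the exterior angles at [A_i]. *)
Definition polygonal_curve A C : Prop :=
  (forall i : 'Z_(n.*2), ~~ odd i ->
     is_segment (A (i - 1)) (A (i + 1)) (C i)) /\
  (forall i : 'Z_(n.*2), odd i ->
     is_vertical_angles (side A (i - 1)) (side A (i + 1)) (C i)).

(** For [i] odd: the edge from [B_(i-1)^*] to [B_(i+1)^*] of the dual curve. *)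
Definition dual_edge A C (i : 'Z_(n.*2)) : set (projsp (dualsp V)) :=
  [set xi | exists l : {vspace V}, [/\ \dim l = 2%N, (val (A i) <= l)%VS,
     (forall p : projsp V, (val p <= l)%VS -> C i p) & val xi = annv l]].

(** For [i] even: the exterior angles of the dual curve at [B_i^*], i.e. the
    union of the lines [p^*] for [p] on the edge [C i]. *)
Definition dual_angles C (i : 'Z_(n.*2)) : set (projsp (dualsp V)) :=
  [set xi | exists2 p : projsp V, C i p & (val xi <= annv (val p))%VS].

(** A map with [A_i |-> B_(i+m)^*] sends the line [B_i] to the line
    [A_(i+m)^*], so the edge [C i] has to match the dual edge of index [i + m];
    likewise for the angles.  [m] is meant to be odd. *)
Definition curve_self_dual (m : nat) A C : Prop :=
  exists f : projsp V -> projsp (dualsp V), [/\ self_duality m A f,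
    forall i : 'Z_(n.*2), ~~ odd i -> f @` C i = dual_edge A C (i + m%:R) &
    forall i : 'Z_(n.*2), odd i -> f @` C i = dual_angles C (i + m%:R)].

End Polygon.

(* Main.v *)
(** Lift the self-duality to a linear map [F : V -> V^*], let [a_i] span the
    vertex [A_i] ([i] odd), and let [phi_j = F a_(j-m)], a functional with kernel
    the side [B_j] ([j] even).  Relative to these vectors the two possible edges
    (or pairs of exterior angles) at an index correspond to the two signs, and
    the curve with signs [e] is [m]-self-dual iff [e_(i+m) = - e_i] up to the sign
    of [kappa_(i-1) kappa_(i+1)], where [F x a_(j+m) = kappa_j phi_j x] ([j] even).
    As [m] is odd, translation by [m] has [gcd (m, n)] orbits on the residues
    modulo [2n], each of even length [2k] with [k = n / gcd (m, n)], and the signs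
    can be chosen freely at one index of each orbit provided that the equations
    are consistent around it.  The endomorphism [H = F^-1 o F^T] sends [a_(j+m)]
    to [kappa_j a_(j-m)], so [F o H^k] induces the same map on the vertices as
    [F]; by uniqueness [H^k] is scalar, hence the product of the [kappa]s around
    an orbit does not depend on the orbit, and since the products of two
    orbits enter, the total sign is a square. *)

Require Import Defs.
From HB Require Import structures.
From mathcomp Require Import all_boot all_order all_algebra.
From mathcomp Require Import all_classical reals.
From mathcomp Require Import ring lra.

Set Implicit Arguments.
Unset Strict Implicit.
Unset Printing Implicit Defensive.

Import Order.TTheory GRing.Theory Num.Theory.
Local Open Scope classical_set_scope.
Local Open Scope card_scope.
Local Open Scope ring_scope.

(** * Cyclic systems of equations in signs *)

(** Curves do not form a finite type, so they are counted through an injective parametrisation by a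
    finite set of sign vectors. *)
Lemma card_eq_finset_image (T : finType) (U : Type) (X : {set T}) (g : T -> U) :
  injective g -> [set y | exists2 x, x \in X & y = g x] #= `I_#|X|.
Proof.
move=> g_inj; have [->|/set0Pn [x0 _]] := eqVneq X finset.set0.
  rewrite cards0 II0 card_eq0; apply/eqP/seteqP.
  by split=> y // [x]; rewrite inE.
rewrite (_ : [set y | _] = (fun k => g (nth x0 (enum X) k)) @` `I_#|X|).
  apply: inj_card_eq => i j; rewrite !inE /= => ltiX ltjX /g_inj /eqP.
  by rewrite nth_uniq ?enum_uniq -?cardE // => /eqP.
apply/seteqP; split=> y /= [x].
  move=> Xx ->; exists (index x (enum X)).
    by rewrite cardE index_mem mem_enum.
  by rewrite nth_index ?mem_enum.
move=> ltxX <-; exists (nth x0 (enum X) x) => //.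
by rewrite -mem_enum mem_nth // -cardE.
Qed.

Section CyclicEquations.
Variables (T : finType) (p : T -> T) (s : T -> bool).
Hypothesis p_inj : injective p.

Let partial_sum x k := (\big[addb/false]_(0 <= u < k) s (iter u p x)).

Hypothesis sum0 : forall x, partial_sum x (order p x) = false.

(** Bits are prescribed at the roots of the cycles of [p] and propagated by partial sums; [h]
    matters only through the roots it contains. *)
Let sol (h : {set T}) : {ffun T -> bool} :=
  [ffun x => (froot p x \in h) (+) partial_sum (froot p x) (findex p (froot p x) x)].

Let connect_froot x : fconnect p (froot p x) x.
Proof. by rewrite fconnect_sym // connect_root. Qed.

Let sol_step h x : sol h (p x) = sol h x (+) s x.
Proof.
have cx := connect_froot x.
have rpx : froot p (p x) = froot p x.
  by apply/eqP; rewrite eq_sym root_connect ?fconnect1 //; apply: fconnect_sym.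
rewrite !ffunE rpx; set r := froot p x in cx *; set k := findex p r x.
have xE : x = iter k p r by rewrite iter_findex.
have sE : partial_sum r k.+1 = partial_sum r k (+) s x.
  by rewrite /partial_sum big_nat_recr //= -xE.
rewrite -addbA -sE; congr addb.
(* Either the step stays inside the cycle, or it returns to the root, where [sum0] makes the
   propagated bit agree with the initial one. *)
have : (k < order p r)%N by apply: findex_max.
rewrite leq_eqVlt => /orP[/eqP kE|ltk]; last first.
  by rewrite [in LHS]xE -iterS findex_iter.
by rewrite kE sum0 [in LHS]xE -iterS kE iter_order // findex0 /partial_sum big_nil.
Qed.

Let sol_unique (e : {ffun T -> bool}) (eP : forall x, e (p x) = e x (+) s x) :
  e = sol [set x | e x & froots p x].
Proof.
have eI x k : e (iter k p x) = e x (+) partial_sum x k.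
  elim: k => [|k IH] /=; first by rewrite /partial_sum big_nil addbF.
  by rewrite eP IH -addbA /partial_sum [in RHS]big_nat_recr.
apply/ffunP => x; rewrite ffunE !inE.
rewrite -{1}[x](iter_findex (connect_froot x)) eI.
by rewrite [froots p _]roots_root ?andbT //; apply: fconnect_sym.
Qed.

(** Consistency around each cycle is [sum0]; one bit per cycle then remains free, so solutions
    correspond to sets of roots. *)
Lemma card_cyclic_equations :
  #|[set e : {ffun T -> bool} | [forall x, e (p x) == e x (+) s x]]%SET|
    = (2 ^ fcard p T)%N.
Proof.
have fs := fconnect_sym p_inj.
have inj : {in powerset [set x | froots p x] &, injective sol}.
  move=> g h; rewrite !inE => /fintype.subsetP gR /fintype.subsetP hR /ffunP E.
  apply/setP=> x; have [xR|xR] := boolP (froots p x); last first.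
    by apply/idP/idP=> [/gR|/hR]; rewrite inE (negPf xR).
  have /eqP rx : froot p x == x by [].
  by have := E x; rewrite !ffunE rx => /addIb.
have -> : fcard p T = #|[set x | froots p x]%SET|.
  by apply: eq_card => x; rewrite !inE andbT.
rewrite -card_powerset -(card_in_imset inj); apply: eq_card => e; rewrite !inE.
apply/forallP/imsetP => [eP|[h _ ->] x]; last by rewrite sol_step.
exists [set x | e x & froots p x]%SET; last by apply: sol_unique => x; apply/eqP.
by rewrite inE; apply/fintype.subsetP=> x; rewrite !inE => /andP[].
Qed.

End CyclicEquations.

(** * Orbits of a translation on residues *)

Section Translation.
Variables (N m : nat).
Hypothesis N_gt1 : (1 < N)%N.
Local Notation shift := (fun x : 'Z_N => x + m%:R).

Lemma natr_Zp_eq0 (k : nat) : ((k%:R : 'Z_N) == 0) = (N %| k)%N.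
Proof. by rewrite -val_eqE /= val_Zp_nat. Qed.

Lemma iter_shift u (x : 'Z_N) : iter u shift x = x + (m * u)%:R.
Proof.
elim: u => [|u IH]; first by rewrite muln0 addr0.
by rewrite iterS IH mulnS addnC natrD addrA.
Qed.

Lemma shift_inj : injective shift.
Proof. by move=> x y /addIr. Qed.

(** With [d] the gcd, [u] steps return to the start iff [N] divides [m * u]; as [N / d] is coprime
    to [m / d], this means that [N / d] divides [u]. *)
Lemma order_shift (x : 'Z_N) : order shift x = (N %/ gcdn m N)%N.
Proof.
have N_gt0 := ltnW N_gt1; set d := gcdn m N; set K := (N %/ d)%N.
have d_gt0 : (0 < d)%N by rewrite gcdn_gt0 N_gt0 orbT.
have NE : N = (K * d)%N by rewrite divnK ?dvdn_gcdr.
have K_gt0 : (0 < K)%N by move: N_gt0; rewrite NE muln_gt0 => /andP[].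
have iterK : iter K shift x = x.
  apply/eqP; rewrite iter_shift -subr_eq0 addrC addKr natr_Zp_eq0.
  by rewrite NE mulnC dvdn_pmul2r // dvdn_gcdl.
apply/eqP; rewrite eqn_leq; apply/andP; split.
  rewrite leqNgt; apply/negP=> /findex_iter.
  by rewrite iterK findex0 => K0; rewrite -K0 in K_gt0.
apply: dvdn_leq; first exact: order_gt0.
have := iter_order shift_inj x; rewrite iter_shift => /eqP.
rewrite -subr_eq0 addrC addKr natr_Zp_eq0 => Nd.
have [m' mE] : exists m', m = (m' * d)%N by apply/dvdnP; exact: dvdn_gcdl.
have cop : coprime K m'.
  have : (gcdn m N == d)%N by [].
  by rewrite {1}mE {1}NE -muln_gcdl -{2}[d]mul1n eqn_pmul2r // /coprime gcdnC.
move: Nd; rewrite {1}NE {1}mE mulnAC dvdn_pmul2r //.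
by rewrite Gauss_dvdr.
Qed.

Lemma fcard_shift : fcard shift 'Z_N = gcdn m N.
Proof.
have N_gt0 := ltnW N_gt1.
have d_gt0 : (0 < gcdn m N)%N by rewrite gcdn_gt0 N_gt0 orbT.
have K_gt0 : (0 < N %/ gcdn m N)%N.
  by rewrite divn_gt0 // dvdn_leq // dvdn_gcdr.
have := @fcard_order_set _ _ shift_inj (N %/ gcdn m N)%N 'Z_N.
rewrite card_ord [in X in _ = X]Zp_cast // => H; apply/eqP.
rewrite -(eqn_pmul2r K_gt0) H.
- by rewrite mulnC divnK ?dvdn_gcdr.
- by apply/fintype.subsetP=> x _; rewrite inE order_shift.
- by [].
Qed.

End Translation.

(** * Segments and angles in a projective space *)

Section Generators.
Variables (K : fieldType) (W : vectType K).
Implicit Types (r : projsp W) (x y : W).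

Lemma projsp_gen r : {x : W | x != 0 & val r = <[x]>%VS}.
Proof.
exists (vpick (val r)).
  by rewrite vpick0 -dimv_eq0 (eqP (valP r)).
apply/esym/eqP; rewrite eqEdim (eqP (valP r)) dim_vline vpick0 -dimv_eq0.
by rewrite (eqP (valP r)) andbT -memvE memv_pick.
Qed.

Lemma projsp_line x : x != 0 -> {r : projsp W | val r = <[x]>%VS}.
Proof.
move=> x0; have d1 : \dim <[x]>%VS == 1%N by rewrite dim_vline x0.
by exists (exist (fun U : {vspace W} => \dim U == 1%N) <[x]>%VS d1).
Qed.

Lemma projsp_inj r r' : val r = val r' -> r = r'.
Proof. exact: val_inj. Qed.

Lemma eq_vline x y : <[x]>%VS = <[y]>%VS -> y != 0 ->
  exists2 k, k != 0 & x = k *: y.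
Proof.
move=> E y0; have /vlineP[k xE] : x \in <[y]>%VS by rewrite -E memv_line.
exists k => //; apply: contraNneq y0 => k0.
have /vlineP[l ->] : y \in <[x]>%VS by rewrite E memv_line.
by rewrite xE k0 scale0r scaler0.
Qed.

Lemma vlineZ k x : k != 0 -> <[k *: x]>%VS = <[x]>%VS.
Proof.
move=> k0; apply/eqP; rewrite eqEsubv -!memvE; apply/andP; split.
  by rewrite memvZ ?memv_line.
by rewrite -{1}[x](scalerK k0) memvZ ?memv_line.
Qed.

Lemma vlineN x : <[- x]>%VS = <[x]>%VS.
Proof. by rewrite -scaleN1r vlineZ // oppr_eq0 oner_eq0. Qed.

(** If [phi] is nonzero, subtracting from [x] a multiple of a vector outside its kernel brings [x]
    into that kernel. *)
Lemma functional_prop (phi psi : 'Hom(W, K^o)) :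
  (forall x, phi x = 0 -> psi x = 0) -> exists k, psi = k *: phi.
Proof.
move=> H; have [phi0|[v phiv]] : (forall x, phi x = 0) \/ exists v, phi v != 0.
  have [->|] := eqVneq phi 0; first by left=> x; rewrite lfunE.
  move=> /eqP nz; right; apply: contrapT => E; apply: nz; apply/lfunP => x.
  by rewrite lfunE; apply: contrapT => /eqP ?; apply: E; exists x.
  by exists 0; apply/lfunP => x; rewrite scale0r lfunE H.
exists (psi v / phi v); apply/lfunP => x; rewrite lfunE /=.
have : psi (x - (phi x / phi v) *: v) = 0.
  apply: H; rewrite linearB linearZ /=.
  by rewrite /GRing.scale /= mulfVK // subrr.
rewrite linearB linearZ /= /GRing.scale /= => /eqP; rewrite subr_eq0 => /eqP ->.
by rewrite mulrC mulrA mulrAC.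
Qed.

End Generators.

(** The ring operations of the values below are those of [K], not of [K^o]. *)
Section Functionals.
Variables (K : fieldType) (W : vectType K).
Implicit Types (phi psi : 'Hom(W, K^o)) (x y : W) (k : K).

Lemma fct0 phi : phi 0 = 0 :> K. Proof. exact: (linear0 phi). Qed.

Lemma fctD phi x y : phi (x + y) = (phi x : K) + (phi y : K) :> K.
Proof. exact: (linearD phi). Qed.

Lemma fctB phi x y : phi (x - y) = (phi x : K) - (phi y : K) :> K.
Proof. exact: (linearB phi). Qed.

Lemma fctZ phi k x : phi (k *: x) = k * (phi x : K) :> K.
Proof. by rewrite linearZ. Qed.

Lemma zero_fctE x : (0 : 'Hom(W, K^o)) x = 0 :> K.
Proof. by rewrite lfunE. Qed.

Lemma add_fctE phi psi x : (phi + psi) x = (phi x : K) + (psi x : K) :> K.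
Proof. by rewrite lfunE. Qed.

Lemma scale_fctE k phi x : (k *: phi) x = k * (phi x : K) :> K.
Proof. by rewrite lfunE. Qed.

End Functionals.

(** * Segments and vertical angles with a sign parameter *)

Section Segments.
Variables (R : realType) (W : vectType R).
Implicit Types (p q r : projsp W) (a b x y : W) (c s t : R) (phi psi : 'Hom(W, R^o)).

(** For fixed generators and [c] nonzero, the sign of [c] selects one of the two segments; the
    condition is insensitive to rescaling [(s, t)]. [sang] treats angles in the same way. *)
Definition sseg c a b : set (projsp W) :=
  [set r : projsp W | exists s t, 0 <= c * (s * t) /\ val r = <[s *: a + t *: b]>%VS].

Definition sang c phi psi : set (projsp W) :=
  [set r : projsp W | forall x, x \in val r -> 0 <= c * (phi x * psi x)].

Lemma is_segmentP p q a b S : val p = <[a]>%VS -> val q = <[b]>%VS ->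
  is_segment p q S <-> exists2 c, c != 0 & S = sseg c a b.
Proof.
move=> pa qb.
have a0 : a != 0.
  by have := valP p; rewrite pa dim_vline; case: (a != 0).
have b0 : b != 0.
  by have := valP q; rewrite qb dim_vline; case: (b != 0).
have key k l : k != 0 -> l != 0 ->
    [set r : projsp W | exists s t : R,
      [/\ 0 <= s, 0 <= t & val r = <[s *: (k *: a) + t *: (l *: b)]>%VS]]
    = sseg (k * l) a b.
  move=> k0 l0; apply/seteqP; split=> r.
    move=> [s [t [s0 t0 rE]]]; exists (s * k), (t * l); split.
      have -> : k * l * (s * k * (t * l)) = (k * l) ^+ 2 * (s * t) by ring.
      by rewrite mulr_ge0 ?sqr_ge0 ?mulr_ge0.
    by rewrite rE !scalerA.
  move=> [s [t [st rE]]].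
  have st' : 0 <= (s / k) * (t / l).
    have -> : (s / k) * (t / l) = ((k * l)^-1) ^+ 2 * (k * l * (s * t)).
      by field; rewrite k0 l0.
    by rewrite mulr_ge0 ?sqr_ge0.
  (* Two negative coordinates are negated together, which keeps the line; for mixed signs the
     product inequality forces the nonnegative coordinate to vanish. *)
  have [sk|sk] := leP 0 (s / k); have [tl|tl] := leP 0 (t / l).
  - by exists (s / k), (t / l); rewrite sk tl rE !scalerA !divfK.
  - have sk0 : s / k = 0 by nra.
    have s0 : s = 0 by rewrite -[s](divfK k0) sk0 mul0r.
    exists 0, (- (t / l)); rewrite lexx oppr_ge0 ltW //; split => //.
    by rewrite rE s0 !scale0r !add0r !scalerA mulNr divfK // scaleNr vlineN.
  - have tl0 : t / l = 0 by nra.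
    have t0 : t = 0 by rewrite -[t](divfK l0) tl0 mul0r.
    exists (- (s / k)), 0; rewrite lexx oppr_ge0 ltW //; split => //.
    by rewrite rE t0 !scale0r !addr0 !scalerA mulNr divfK // scaleNr vlineN.
  - exists (- (s / k)), (- (t / l)); rewrite !oppr_ge0 !ltW //; split => //.
    by rewrite rE !scalerA !mulNr !divfK // !scaleNr -opprD vlineN.
split=> [[a' [b' [pa' qb' ->]]]|[c c0 ->]].
  have [k k0 aE] : exists2 k, k != 0 & a' = k *: a
    by apply: eq_vline => //; rewrite -pa'.
  have [l l0 bE] : exists2 l, l != 0 & b' = l *: b
    by apply: eq_vline => //; rewrite -qb'.
  by exists (k * l); rewrite ?mulf_neq0 // -key // -aE -bE.
exists a, (c *: b); split=> //; first by rewrite vlineZ.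
rewrite -[c in sseg c]mul1r -key ?oner_eq0 //.
by apply/seteqP; split=> r [s [t H]]; exists s, t; move: H; rewrite scale1r.
Qed.

Lemma sseg_eq c c' a b : (forall s t, s *: a + t *: b = 0 -> s = 0 /\ t = 0) ->
  c != 0 -> c' != 0 -> sseg c a b = sseg c' a b <-> 0 < c * c'.
Proof.
move=> fab c0 c'0; split=> [E|cc']; last first.
  have [cp|cn] := ltP 0 c.
    have c'p : 0 < c' by rewrite -(pmulr_rgt0 _ cp).
    by apply/seteqP; split=> r [s [t [st rE]]]; exists s, t; split=> //;
      move: st; rewrite !(pmulr_rge0 _ cp) !(pmulr_rge0 _ c'p).
  have {}cn : c < 0 by rewrite lt_neqAle c0.
  have c'n : c' < 0 by move: cc'; rewrite nmulr_rgt0.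
  by apply/seteqP; split=> r [s [t [st rE]]]; exists s, t; split=> //;
      move: st; rewrite !(nmulr_rge0 _ cn) !(nmulr_rge0 _ c'n).
(* The point spanned by [c *: a + b] lies in the segment of [c] and tells the two signs apart. *)
have ab0 : c *: a + b != 0.
  by apply: contraNneq c0 => H; have [] := fab c 1; rewrite ?scale1r // => ->.
have [r rE] := projsp_line ab0.
have : sseg c a b r.
  exists c, 1; rewrite scale1r; split=> //; rewrite mulr1; exact: sqr_ge0.
rewrite E => -[s [t [st]]]; rewrite rE => /esym/eq_vline /(_ ab0)[k k0 H].
have [] := fab (s - k * c) (t - k).
  rewrite !scalerBl addrACA H -opprD -scalerA -scalerDr subrr //.
move=> /eqP; rewrite subr_eq0 => /eqP sE /eqP; rewrite subr_eq0 => /eqP tE.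
move: st; rewrite sE tE.
have -> : c' * (k * c * k) = k ^+ 2 * (c * c') by ring.
rewrite pmulr_rge0 ?exprn_even_gt0 // => ?.
by rewrite lt_neqAle eq_sym mulf_neq0.
Qed.

(** Functionals with the same kernel are proportional, and the factors are absorbed by [c]. *)
Lemma is_vertical_anglesP phi psi S :
  is_vertical_angles (lker phi) (lker psi) S <->
  exists2 c, c != 0 & S = sang c phi psi.
Proof.
have ker_prop (f g : 'Hom(W, R^o)) : lker f = lker g -> exists2 k, k != 0 & g = k *: f.
  move=> E; have [g0|g0] := eqVneq g 0.
    exists 1; rewrite ?oner_eq0 // scale1r g0; apply/lfunP => x.
    have : x \in lker f by rewrite E g0 memv_ker lfunE.
    by rewrite memv_ker lfunE => /eqP ->.
  have [x|k gE] := @functional_prop _ _ f g.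
    by move=> fx; apply/eqP; rewrite -memv_ker -E memv_ker fx.
  by exists k => //; apply: contraNneq g0 => k0; rewrite gE k0 scale0r.
split=> [[f [g [kf kg ->]]]|[c c0 ->]].
  have [k k0 fE] := ker_prop _ _ (esym kf).
  have [l l0 gE] := ker_prop _ _ (esym kg).
  exists (k * l); rewrite ?mulf_neq0 //; apply/seteqP; split=> r H x /H;
  by rewrite fE gE !lfunE /= /GRing.scale /= mulrACA.
exists phi, (c *: psi); split=> //.
  apply/vspaceP=> x; rewrite !memv_ker lfunE /= /GRing.scale /=.
  by rewrite mulf_eq0 (negPf c0).
by apply/seteqP; split=> r H x /H; rewrite lfunE /= /GRing.scale /= mulrCA.
Qed.

Lemma sang_eq c c' phi psi x : phi x != 0 -> psi x != 0 ->
  (exists2 y, phi y = 0 & psi y != 0) ->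
  c != 0 -> c' != 0 -> sang c phi psi = sang c' phi psi <-> 0 < c * c'.
Proof.
move=> px sx [y py sy] c0 c'0; split=> [E|cc']; last first.
  have [cp|cn] := ltP 0 c.
    have c'p : 0 < c' by rewrite -(pmulr_rgt0 _ cp).
    by apply/seteqP; split=> r H z /H; rewrite !(pmulr_rge0 _ cp) !(pmulr_rge0 _ c'p).
  have {}cn : c < 0 by rewrite lt_neqAle c0.
  have c'n : c' < 0 by move: cc'; rewrite nmulr_rgt0.
  by apply/seteqP; split=> r H z /H; rewrite !(nmulr_rge0 _ cn) !(nmulr_rge0 _ c'n).
(* Moving along [y] keeps [phi] fixed and lets [psi z] be [c * phi x], so that [c * (phi z * psi z)]
   is a nonzero square. *)
pose z := x + ((c * phi x - psi x) / psi y) *: y.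
have pz : phi z = phi x by rewrite /z fctD fctZ py mulr0 addr0.
have sz : psi z = c * phi x.
  by rewrite /z fctD fctZ divfK // addrC subrK.
have z0 : z != 0 by apply: contraNneq px => z0; rewrite -pz z0 linear0.
have [r rE] := projsp_line z0.
have : sang c phi psi r.
  move=> w; rewrite rE => /vlineP[k ->]; rewrite !fctZ pz sz.
  have -> : c * (k * phi x * (k * (c * phi x))) = (c * k * phi x) ^+ 2 by ring.
  exact: sqr_ge0.
rewrite E => /(_ z); rewrite rE memv_line => /(_ isT); rewrite pz sz.
have -> : c' * (phi x * (c * phi x)) = (phi x) ^+ 2 * (c * c') by ring.
rewrite pmulr_rge0 ?exprn_even_gt0 // => ?.
by rewrite lt_neqAle eq_sym mulf_neq0.
Qed.

End Segments.

(** * Bases and functionals in dimension three *)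

Section Frames.
Variables (K : fieldType) (W : vectType K).
Hypothesis dimW : \dim {:W} = 3%N.
Implicit Types (a b c x : W).

Definition frame a b c :=
  (forall x, exists s t u, x = s *: a + t *: b + u *: c) /\
  (forall s t u, s *: a + t *: b + u *: c = 0 -> [/\ s = 0, t = 0 & u = 0]).

(** A basis of [U] followed by one of a complement is cut after two vectors. Thus dependent points
    are collinear even when they span less than a plane. *)
Lemma subspace_plane (U : {vspace W}) :
  (\dim U <= 2)%N -> exists2 l : {vspace W}, \dim l = 2%N & (U <= l)%VS.
Proof.
move=> dimU; set X := vbasis U ++ vbasis (U^C)%VS.
have bX : basis_of {:W} X.
  have dU : directv (U + U^C) by apply/directv_addP; exact: capv_compl.
  by rewrite -(addv_complf U); apply: (cat_basis dU); exact: vbasisP.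
have szX : size X = 3%N.
  by rewrite size_cat !size_tuple dimv_compl subnKC ?dimW // (leq_trans dimU).
have fX := basis_free bX.
exists <<take 2 X>>%VS.
  have /eqP -> : free (take 2 X).
    by rewrite -(cat_take_drop 2 X) in fX; exact: catl_free fX.
  by rewrite size_take szX.
rewrite -(span_basis (vbasisP U)); apply: sub_span => x xU.
by rewrite /X take_cat size_tuple ltnNge dimU /= mem_cat xU.
Qed.

Lemma noncollinear_frame (p q r : projsp W) a b c :
  val p = <[a]>%VS -> val q = <[b]>%VS -> val r = <[c]>%VS ->
  ~ collinear p q r -> frame a b c.
Proof.
move=> pa qb rc ncol.
have sp : (<[a]> + <[b]> + <[c]>)%VS = <<[:: a; b; c]>>%VS.
  by rewrite !span_cons span_nil addv0 addvA.
have fr : free [:: a; b; c].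
  apply: contrapT => /negP nf; apply: ncol.
  have [|l dl lP] := @subspace_plane (<[a]> + <[b]> + <[c]>)%VS.
    rewrite sp -ltnS ltn_neqAle (dim_span [:: a; b; c]) andbT.
    exact: nf.
  exists l; split=> //; move: lP; rewrite !subv_add -andbA pa qb rc.
  by case/and3P.
split=> [x|s t u E].
  have : x \in {:W}%VS by exact: memvf.
  have -> : {:W}%VS = (<[a]> + <[b]> + <[c]>)%VS.
    apply/esym/eqP; rewrite eqEdim subvf dimW sp.
    by move/eqP: fr => ->.
  move=> /memv_addP[y /memv_addP[_ /vlineP[s ->] [_ /vlineP[t ->] ->]]].
  by move=> [_ /vlineP[u ->] ->]; exists s, t, u.
have /freeP H : free [tuple a; b; c] by [].
pose k (i : 'I_3) := tnth [tuple s; t; u] i.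
have k0 := H k; have {}k0 : forall i, k i = 0.
  by apply: k0; rewrite !big_ord_recl big_ord0 addr0 /= addrA.
split; [exact: (k0 ord0) | exact: (k0 1) | exact: (k0 2%:R)].
Qed.

Lemma eq_functional_frame a b c (phi psi : 'Hom(W, K^o)) : frame a b c ->
  phi a = psi a -> phi b = psi b -> phi c = psi c -> phi = psi.
Proof.
move=> [sp _] ea eb ec; apply/lfunP=> x; have [s [t [u ->]]] := sp x.
by rewrite !linearD !linearZ /= ea eb ec.
Qed.

Lemma dim_lker_functional (chi : 'Hom(W, K^o)) : chi != 0 -> \dim (lker chi) = 2%N.
Proof.
move=> chi0; have := limg_ker_dim chi fullv; rewrite capfv dimW.
have -> : \dim (limg chi) = 1%N; last by rewrite addn1 => -[].
apply/eqP; rewrite eqn_leq lt0n dimv_eq0 -lkerE; apply/andP; split.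
  by rewrite (leq_trans (dimvS (subvf _))) // dimvf.
apply: contra chi0 => /subvP H; apply/eqP/lfunP => x.
by apply/eqP; rewrite lfunE -memv_ker H ?memvf.
Qed.

End Frames.

(** * Duals of angles and of segments *)

Section DualRegions.
Variables (R : realType) (W : vectType R).
Hypothesis dimW : \dim {:W} = 3%N.
Implicit Types (o a b x y : W) (c s t u v : R) (phi psi chi : 'Hom(W, R^o)).

(** This is where duality reverses signs: [(u, v)] is a multiple of [(- t, s)], so [u * v] is
    [- (s * t)] times a square. *)
Lemma opposite_signs c s t u v : s != 0 \/ t != 0 ->
  0 <= c * (s * t) -> s * u + t * v = 0 -> 0 <= - c * (u * v).
Proof.
move=> st0 cst E.
have [s0|s0] := eqVneq s 0.
  have t0 : t != 0 by case: st0 => //; rewrite s0 eqxx.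
  have -> : v = 0.
    by move: E; rewrite s0 mul0r add0r => /eqP; rewrite mulf_eq0 (negPf t0) => /eqP.
  by rewrite !mulr0.
have -> : u = - (t * v) / s.
  by move/eqP: E; rewrite addr_eq0 => /eqP <-; rewrite mulrAC divff ?mul1r.
have -> : - c * (- (t * v) / s * v) = (c * (s * t)) * (v / s) ^+ 2 by field.
by rewrite mulr_ge0 ?sqr_ge0.
Qed.

Lemma annv_lker chi : annv (lker chi) = <[chi : dualsp W]>%VS.
Proof.
apply/vspaceP=> phi; apply/mem_annv/vlineP => [H|[k ->] x].
  by apply: functional_prop => x chix; apply: H; rewrite memv_ker chix.
by rewrite memv_ker => /eqP E; rewrite scale_fctE E mulr0.
Qed.

(** A line through [o] is the kernel of some [s *: phi + t *: psi], on which [phi] and [psi] are in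
    proportion to [- t] and [s]. *)
Lemma lines_in_vertical_angles c o p q phi psi (P : projsp W) :
  val P = <[o]>%VS -> frame o p q ->
  [/\ phi o = 0, phi p = 0 & phi q != 0] ->
  [/\ psi o = 0, psi p != 0 & psi q = 0] ->
  [set xi : projsp (dualsp W) | exists l : {vspace W},
     [/\ \dim l = 2%N, (val P <= l)%VS,
         forall r : projsp W, (val r <= l)%VS -> sang c phi psi r & val xi = annv l]]
  = sseg (- c) (phi : dualsp W) psi.
Proof.
move=> Po fr [phio phip phiq] [psio psip psiq].
apply/seteqP; split=> xi.
  move=> [l [dl Pl lc xil]]; have [chi chi0 xichi] := projsp_gen xi.
  have lE : l = lker chi.
    apply/eqP; rewrite eqEdim dl (dim_lker_functional dimW chi0) leqnn andbT.
    apply/subvP=> x xl; rewrite memv_ker.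
    have /mem_annv H : (chi : dualsp W) \in annv l by rewrite -xil xichi memv_line.
    by rewrite H.
  have chio : chi o = 0.
    by apply/eqP; rewrite -memv_ker -lE memvE -Po.
  pose s : R := chi q / phi q; pose t : R := chi p / psi p.
  have chiE : chi = s *: phi + t *: psi.
    apply: (eq_functional_frame fr); rewrite add_fctE !scale_fctE.
    - by rewrite chio phio psio !mulr0 addr0.
    - by rewrite phip mulr0 add0r divfK.
    - by rewrite psiq mulr0 addr0 divfK.
  exists s, t; split; last by rewrite xichi chiE.
  (* A vector of the line where [phi] is [- t] and [psi] is [s]; if it is zero then so is [s], and
     the inequality is trivial. *)
  pose x := (s / psi p) *: p - (t / phi q) *: q.
  have phix : phi x = - t.
    by rewrite fctB !fctZ phip mulr0 sub0r divfK.
  have psix : psi x = s.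
    by rewrite fctB !fctZ psiq mulr0 subr0 divfK.
  have [x0|x0] := eqVneq x 0; first by rewrite -psix x0 fct0 mul0r mulr0.
  have [r rE] := projsp_line x0.
  have : sang c phi psi r.
    apply: lc; rewrite rE -memvE lE memv_ker chiE add_fctE !scale_fctE phix psix.
    by rewrite mulrN mulrC addNr.
  move=> /(_ x); rewrite rE memv_line => /(_ isT); rewrite phix psix.
  by rewrite mulNr mulrN mulNr (mulrC t).
move=> [s [t [st xiE]]]; set chi := (s *: _ + _) in xiE.
have chi0 : chi != 0.
  by have := valP xi; rewrite xiE dim_vline; case: (chi != 0).
have st0 : s != 0 \/ t != 0.
  have [s0|] := eqVneq s 0; last by left.
  right; apply: contraNneq chi0 => t0.
  by rewrite /chi s0 t0 !scale0r addr0.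
have chiE x : chi x = s * phi x + t * psi x.
  by rewrite add_fctE !scale_fctE.
exists (lker chi); split.
- exact: dim_lker_functional.
- by rewrite Po -memvE memv_ker chiE phio psio !mulr0 addr0.
- move=> r rl x xr; have xl : x \in lker chi by apply: subvP rl x xr.
  rewrite -[c]opprK; apply: (opposite_signs st0 st).
  by move: xl; rewrite memv_ker chiE => /eqP.
- by rewrite annv_lker.
Qed.

(** Unless [chi] vanishes at both ends, its kernel meets the line of [a] and [b] at
    [chi b *: a - chi a *: b], whose coefficients have product [- (chi a * chi b)]. *)
Lemma lines_meeting_segment c a b :
  (forall s t, s *: a + t *: b = 0 -> s = 0 /\ t = 0) ->
  [set xi : projsp (dualsp W) |
     exists2 p : projsp W, sseg c a b p & (val xi <= annv (val p))%VS]
  = [set xi : projsp (dualsp W) | forall chi, (chi : dualsp W) \in val xi ->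
       0 <= - c * (chi a * chi b)].
Proof.
move=> fab; apply/seteqP; split=> xi.
  move=> [p [s [t [st pE]]] xip] chi chixi.
  have v0 : s *: a + t *: b != 0.
    by have := valP p; rewrite pE dim_vline; case: (_ != 0).
  have st0 : s != 0 \/ t != 0.
    have [s0|] := eqVneq s 0; last by left.
    by right; apply: contraNneq v0 => t0; rewrite s0 t0 !scale0r addr0.
  apply: (opposite_signs st0 st).
  have /mem_annv/(_ (s *: a + t *: b)) : (chi : dualsp W) \in annv (val p).
    by apply: subvP xip _ chixi.
  by rewrite pE memv_line fctD !fctZ => /(_ isT).
move=> H; have [chi chi0 xiE] := projsp_gen xi.
have {}H : 0 <= - c * (chi a * chi b) by apply: H; rewrite xiE memv_line.
have a0 : a != 0.
  apply/eqP => a0; have [|/eqP + _] := fab 1 0.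
    by rewrite a0 scaler0 scale0r addr0.
  by rewrite oner_eq0.
have key s t : s != 0 \/ t != 0 -> 0 <= c * (s * t) -> s * chi a + t * chi b = 0 ->
    exists2 p : projsp W, sseg c a b p & (val xi <= annv (val p))%VS.
  move=> st0 cst E; have v0 : s *: a + t *: b != 0.
    apply/eqP => /fab[s0 t0]; move: st0; rewrite s0 t0 eqxx.
    by case.
  have [p pE] := projsp_line v0; exists p; first by exists s, t.
  rewrite xiE -memvE; apply/mem_annv => x; rewrite pE => /vlineP[k ->].
  by rewrite fctZ fctD !fctZ E mulr0.
have [ca|ca] := eqVneq (chi a) 0.
  apply: (key 1 0); first by left; rewrite oner_eq0.
    by rewrite !mulr0.
  by rewrite ca mulr0 mul0r addr0.
apply: (key (chi b) (- chi a)); first by right; rewrite oppr_eq0.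
  by move: H; rewrite mulrN mulrN mulNr mulrC (mulrC (chi a)) (mulrC _ c).
by rewrite mulNr mulrC addrN.
Qed.

End DualRegions.

(** * Images of regions under a projective isomorphism *)

Section ProjectiveImages.
Variables (R : realType) (W W' : vectType R) (f : projsp W -> projsp W').
Variable F : 'Hom(W, W').
Hypotheses (F_inj : lker F == 0%VS) (F_full : limg F = fullv).
Hypothesis fF : forall p, val (f p) = (F @: val p)%VS.

Lemma proj_iso_inj : injective f.
Proof.
move=> p q /(congr1 val); rewrite !fF => /eqP.
by rewrite eq_limg_ker0 // => /eqP /projsp_inj.
Qed.

Lemma proj_iso_surj q : exists p, f p = q.
Proof.
have [y y0 qE] := projsp_gen q.
have yF : y \in limg F by rewrite F_full memvf.
have x0 : (F^-1)%VF y != 0.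
  by apply: contraNneq y0 => x0; rewrite -(limg_lfunVK yF) x0 linear0.
have [p pE] := projsp_line x0; exists p; apply: projsp_inj.
by rewrite fF pE limg_line limg_lfunVK.
Qed.

Lemma image_sseg c a b : f @` sseg c a b = sseg c (F a) (F b).
Proof.
apply/seteqP; split=> [_ [p [s [t [st pE]]] <-]|q [s [t [st qE]]]].
  by exists s, t; split=> //; rewrite fF pE limg_line linearD !linearZ.
have [p pq] := proj_iso_surj q; exists p => //; exists s, t; split=> //.
apply/eqP; rewrite -(eq_limg_ker0 _ _ F_inj) -fF pq qE limg_line.
by rewrite linearD !linearZ.
Qed.

Lemma image_points (P : W -> Prop) (P' : W' -> Prop) :
  (forall x, P' (F x) <-> P x) ->
  f @` [set r : projsp W | forall x, x \in val r -> P x]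
  = [set r : projsp W' | forall y, y \in val r -> P' y].
Proof.
move=> PP'; apply/seteqP; split=> [_ [p H <-] y|q H].
  by rewrite fF => /memv_imgP[x xp ->]; apply/PP'/H.
have [p pq] := proj_iso_surj q; exists p => // x xp.
by apply/PP'/H; rewrite -pq fF memv_img.
Qed.

End ProjectiveImages.

(** * Bilinear forms, iterates and induced projective maps *)

Section Forms.
Variables (K : fieldType) (W : vectType K).
Implicit Types F G : 'Hom(W, dualsp W).

Lemma exists_transpose F : exists G, forall x y : W, G y x = F x y :> K.
Proof.
have lin y : linear (fun x : W => F x y : K^o).
  by move=> k x x'; rewrite linearP lfunE /= lfunE.
pose g y : {linear W -> K^o} := HB.pack_for {linear W -> K^o}
  (fun x : W => F x y : K^o) (GRing.isLinear.Build _ _ _ _ _ (lin y)).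
pose h y : dualsp W := linfun (g y).
have hE y x : h y x = F x y by rewrite lfunE.
have hlin : linear h.
  move=> k y y'; apply/lfunP => x; rewrite hE linearP.
  by rewrite !lfunE /= !lfunE /= !hE.
pose G : {linear W -> dualsp W} := HB.pack_for {linear W -> dualsp W}
  h (GRing.isLinear.Build _ _ _ _ _ hlin).
by exists (linfun G) => x y; rewrite lfunE /= hE.
Qed.

Lemma functional_separates (y : W) : (forall chi : 'Hom(W, K^o), chi y = 0) -> y = 0.
Proof.
move=> H; rewrite (coord_vbasis (memvf y)) big1 // => i _.
have := H (linfun (coord (vbasis fullv) i : W -> K^o)).
by rewrite lfunE /= => ->; rewrite scale0r.
Qed.

Lemma exists_iter_lfun (G : 'End(W)) k :
  exists Gk : 'End(W), forall x, Gk x = iter k G x.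
Proof.
elim: k => [|k [Gk GkE]]; first by exists \1%VF => x; rewrite lfunE.
by exists (G \o Gk)%VF => x; rewrite lfunE /= GkE.
Qed.

Lemma exists_proj_map (W' : vectType K) (G : 'Hom(W, W')) : lker G == 0%VS ->
  exists g : projsp W -> projsp W', forall p, val (g p) = (G @: val p)%VS.
Proof.
move=> G0; have d p : \dim (G @: val (p : projsp W))%VS == 1%N.
  by rewrite limg_dim_eq ?(eqP (valP p)) // (eqP G0) capv0.
by exists (fun p => exist (fun U : {vspace W'} => \dim U == 1%N) _ (d p)).
Qed.

End Forms.

(** * Parity of residues modulo an even number *)

Section Parity.
Variable n : nat.
Hypothesis n_gt0 : (0 < n)%N.
Implicit Types i j : 'Z_(n.*2).

Lemma double_gt1 : (1 < n.*2)%N.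
Proof. by case: n n_gt0 => // k _; rewrite doubleS. Qed.

Lemma oddZ_nat k : odd (k%:R : 'Z_(n.*2)) = odd k.
Proof. by rewrite /= val_Zp_nat ?double_gt1 // odd_mod ?odd_double. Qed.

Lemma oddZD i j : odd (i + j)%R = odd i (+) odd j.
Proof.
rewrite -[i in LHS]natr_Zp -[j in LHS]natr_Zp -natrD oddZ_nat.
exact: oddD.
Qed.

Lemma oddZB i j : odd (i - j)%R = odd i (+) odd j.
Proof.
by have := oddZD (i - j) j; rewrite subrK => ->; rewrite -addbA addbb addbF.
Qed.

Lemma oddZ1 : odd (1%R : 'Z_(n.*2)).
Proof. exact: (oddZ_nat 1). Qed.

End Parity.

(** * Self-dual polygons *)

Section SelfDualPolygon.
Variables (R : realType) (n m : nat).
Local Notation V := 'rV[R]_3.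
Local Notation Z := 'Z_(n.*2).
Variable A : Z -> projsp V.
Hypotheses (n_gt0 : (0 < n)%N) (m_odd : odd m).
Hypothesis A_nondeg : nondegenerate_polygon A.
Variables (f : projsp V -> projsp (dualsp V)) (F : 'Hom(V, dualsp V)).
Hypotheses (F_inj : lker F == 0%VS) (F_full : limg F = fullv).
Hypothesis fF : forall p, val (f p) = (F @: val p)%VS.
Hypothesis f_dual : forall i : Z, odd i -> val (f (A i)) = annv (side A (i + m%:R)).
Implicit Types (i j : Z) (x y : V) (c : R).

Let dimV : \dim {:V} = 3%N.
Proof. by rewrite dimvf dim_matrix. Qed.

Let oD := oddZD n_gt0.
Let oB := oddZB n_gt0.
Let o1 := oddZ1 n_gt0.
Let oN := oddZ_nat n_gt0.

Let a i : V := s2val (projsp_gen (A i)).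

Let aE i : val (A i) = <[a i]>%VS.
Proof. exact: (s2valP' (projsp_gen (A i))). Qed.

Let a_neq0 i : a i != 0.
Proof. exact: (s2valP (projsp_gen (A i))). Qed.

Let a_frame i : odd i -> frame (a (i - 2%:R)) (a i) (a (i + 2%:R)).
Proof. by move=> /A_nondeg; apply: noncollinear_frame. Qed.

Let phi j : 'Hom(V, R^o) := F (a (j - m%:R)).

Let annF i x : odd i -> x \in side A (i + m%:R) -> (F (a i) : 'Hom(V, R^o)) x = 0.
Proof.
move=> oi xS; have /mem_annv H : F (a i) \in annv (side A (i + m%:R)).
  by rewrite -f_dual // fF aE limg_line memv_line.
exact: H.
Qed.

Let a_sideL j : a (j - 1) \in side A j.
Proof. by rewrite /side aE memvE addvSl. Qed.

Let a_sideR j : a (j + 1) \in side A j.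
Proof. by rewrite /side (aE (j + 1)) memvE addvSr. Qed.

Let phi_side j x : ~~ odd j -> x \in side A j -> phi j x = 0 :> R.
Proof.
move=> oj xS; apply: annF; first by rewrite oB oN m_odd (negPf oj).
by rewrite subrK.
Qed.

Let phiL j : ~~ odd j -> phi j (a (j - 1)) = 0 :> R.
Proof. by move=> oj; apply: phi_side. Qed.

Let phiR j : ~~ odd j -> phi j (a (j + 1)) = 0 :> R.
Proof. by move=> oj; apply: phi_side. Qed.

Let phi_neq0 j : phi j != 0.
Proof.
apply: contraNneq (a_neq0 (j - m%:R)) => E.
by apply/eqP/(lker0P F_inj); rewrite linear0.
Qed.

Let frame_next j : ~~ odd j -> frame (a (j - 1)) (a (j + 1)) (a (j + 3%:R)).
Proof.
move=> oj; have := @a_frame (j + 1); rewrite oD o1 (negPf oj) => /(_ isT).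
have -> : j + 1 - 2%:R = j - 1 by ring.
by have -> : j + 1 + 2%:R = j + 3%:R by ring.
Qed.

Let frame_prev j : ~~ odd j -> frame (a (j - 3%:R)) (a (j - 1)) (a (j + 1)).
Proof.
move=> oj; have := @a_frame (j - 1); rewrite oB o1 (negPf oj) => /(_ isT).
have -> : j - 1 - 2%:R = j - 3%:R by ring.
by have -> : j - 1 + 2%:R = j + 1 by ring.
Qed.

(** Injectivity of [F] keeps [phi j] nonzero; it kills two members of a frame, so it cannot kill the
    third. *)
Let phi_next j : ~~ odd j -> phi j (a (j + 3%:R)) != 0 :> R.
Proof.
move=> oj; apply: contraNneq (phi_neq0 j) => H; apply/eqP.
by apply: (eq_functional_frame (frame_next oj)); rewrite zero_fctE // ?phi_side.
Qed.

Let phi_prev j : ~~ odd j -> phi j (a (j - 3%:R)) != 0 :> R.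
Proof.
move=> oj; apply: contraNneq (phi_neq0 j) => H; apply/eqP.
by apply: (eq_functional_frame (frame_prev oj)); rewrite zero_fctE // ?phi_side.
Qed.

Let lker_phi j : ~~ odd j -> lker (phi j) = side A j.
Proof.
move=> oj; apply/eqP; rewrite eqEsubv; apply/andP; split; apply/subvP => x.
  have [sp _] := frame_next oj; have [s [t [u ->]]] := sp x.
  rewrite memv_ker 2!fctD !fctZ phiL // phiR // !mulr0 !add0r.
  rewrite mulf_eq0 (negPf (phi_next oj)) orbF => /eqP ->.
  by rewrite scale0r addr0 memvD ?memvZ.
by move=> xS; rewrite memv_ker phi_side.
Qed.

(** For either sign of [c != 0], one of the two possible values at [i] of a
    polygonal curve; see [polygonal_curveP] and [region_eq]. *)
Definition region i c : set (projsp V) :=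
  if odd i then sang c (phi (i - 1)) (phi (i + 1)) else sseg c (a (i - 1)) (a (i + 1)).

Lemma polygonal_curveP C :
  polygonal_curve A C <-> forall i, exists2 c, c != 0 & C i = region i c.
Proof.
split=> [[Ce Co] i|H]; last split=> i oi.
- rewrite /region; have [oi|oi] := boolP (odd i); last first.
    exact/(is_segmentP _ (aE _) (aE _))/Ce.
  apply/is_vertical_anglesP; rewrite !lker_phi ?oB ?oD ?oi ?o1 //.
  exact: Co.
- by apply/(is_segmentP _ (aE _) (aE _)); have := H i; rewrite /region (negPf oi).
- have := H i; rewrite /region oi => Ci.
  have /is_vertical_anglesP := Ci; rewrite !lker_phi ?oB ?oD ?oi ?o1; exact.
Qed.

Let a_free i s t : ~~ odd i -> s *: a (i - 1) + t *: a (i + 1) = 0 -> s = 0 /\ t = 0.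
Proof.
move=> oi E; have [_ /(_ s t 0)] := frame_next oi.
by rewrite scale0r addr0 => /(_ E)[].
Qed.

Lemma region_eq i c c' : c != 0 -> c' != 0 ->
  region i c = region i c' <-> 0 < c * c'.
Proof.
move=> c0 c'0; rewrite /region; case: ifPn => oi; last first.
  by apply: sseg_eq => // s t; apply: a_free.
have eL : ~~ odd (i - 1)%R by rewrite oB oi o1.
have eR : ~~ odd (i + 1)%R by rewrite oD oi o1.
have pR : phi (i - 1) (a (i + 2%:R)) != 0 :> R.
  by have := phi_next eL; have -> : i - 1 + 3%:R = i + 2%:R by ring.
have qL : phi (i + 1) (a (i - 2%:R)) != 0 :> R.
  by have := phi_prev eR; have -> : i + 1 - 3%:R = i - 2%:R by ring.
have pL : phi (i - 1) (a (i - 2%:R)) = 0 :> R.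
  by apply: phi_side => //; have := a_sideL (i - 1);
    have -> : i - 1 - 1 = i - 2%:R by ring.
have qR : phi (i + 1) (a (i + 2%:R)) = 0 :> R.
  by apply: phi_side => //; have := a_sideR (i + 1);
    have -> : i + 1 + 1 = i + 2%:R by ring.
(* [phi (i - 1)] kills the first summand only and [phi (i + 1)] the second only, so neither vanishes
   at the sum. *)
apply: (@sang_eq _ _ _ _ _ _ (a (i - 2%:R) + a (i + 2%:R))) => //.
- by rewrite fctD pL add0r.
- by rewrite fctD qR addr0.
- by exists (a (i - 2%:R)).
Qed.

(** At odd [j] the value is a dummy, which makes [gamma i] below equal to [1]
    for [i] even. *)
Definition kappa j : R :=
  if odd j then 1 else
    ((F (a (j + 3%:R)) : 'Hom(V, R^o)) (a (j + m%:R)) : R) / phi j (a (j + 3%:R)).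

(** Both sides are linear in [x] and vanish at [a (j - 1)] and [a (j + 1)], because [a (j + m)] lies
    on the sides of index [j - 1 + m] and [j + 1 + m]; [kappa] matches them at [a (j + 3)]. *)
Lemma kappaP j x : ~~ odd j ->
  (F x : 'Hom(V, R^o)) (a (j + m%:R)) = kappa j * (phi j x : R) :> R.
Proof.
move=> oj; rewrite /kappa (negPf oj).
have [sp _] := frame_next oj; have [s [t [u ->]]] := sp x.
have F1 : (F (a (j - 1)) : 'Hom(V, R^o)) (a (j + m%:R)) = 0.
  apply: annF; first by rewrite oB o1 (negPf oj).
  have := a_sideR (j - 1 + m%:R).
  by have -> : j - 1 + m%:R + 1 = j + m%:R by ring.
have F2 : (F (a (j + 1)) : 'Hom(V, R^o)) (a (j + m%:R)) = 0.
  apply: annF; first by rewrite oD o1 (negPf oj).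
  have := a_sideL (j + 1 + m%:R).
  by have -> : j + 1 + m%:R - 1 = j + m%:R by ring.
rewrite 2!fctD !fctZ !linearD !linearZ /= 2!add_fctE !scale_fctE F1 F2.
rewrite phiL // phiR // !mulr0 !add0r mulrCA divfK //.
exact: phi_next.
Qed.

(** Otherwise, for even [j], every functional would vanish at [a (j + m)], since [F] is onto. *)
Lemma kappa_neq0 j : kappa j != 0.
Proof.
have [oj|oj] := boolP (odd j); first by rewrite /kappa oj oner_eq0.
apply: contraNneq (a_neq0 (j + m%:R)) => k0; apply/eqP.
apply: functional_separates => chi.
have chiF : (chi : dualsp V) \in limg F by rewrite F_full memvf.
have := kappaP ((F^-1)%VF chi) oj.
by rewrite (limg_lfunVK chiF) k0 mul0r.
Qed.

(** At odd [i], the ratio between the product of the values of [F x] at the two ends of the side of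
    index [i + m] and [phi (i - 1) x * phi (i + 1) x]. *)
Definition gamma i := kappa (i - 1) * kappa (i + 1).

(** [F] carries the ends [a (i - 1)] and [a (i + 1)] to the functionals bounding the angles at
    [i + m]; duality contributes the minus sign. *)
Lemma dual_edge_region C i c : ~~ odd i -> C (i + m%:R) = region (i + m%:R) c ->
  dual_edge A C (i + m%:R) = f @` region i (- c * gamma i).
Proof.
move=> oi CE; have oim : odd (i + m%:R)%R by rewrite oD oN m_odd (negPf oi).
have g1 : gamma i = 1.
  by rewrite /gamma /kappa oB oD o1 (negPf oi) mulr1.
rewrite g1 mulr1 /region (negPf oi) (image_sseg F_inj F_full fF).
rewrite /dual_edge CE /region oim.
have eL : ~~ odd (i + m%:R - 1)%R by rewrite oB oim o1.
have eR : ~~ odd (i + m%:R + 1)%R by rewrite oD oim o1.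
have E1 : F (a (i - 1)) = phi (i + m%:R - 1).
  by rewrite /phi; congr (F (a _)); ring.
have E2 : F (a (i + 1)) = phi (i + m%:R + 1).
  by rewrite /phi; congr (F (a _)); ring.
rewrite E1 E2; set k := i + m%:R in oim eL eR *.
(* Both functionals vanish at [a k]; besides, [phi (k - 1)] vanishes at [a (k - 2)] and
   [phi (k + 1)] at [a (k + 2)]. *)
apply: (@lines_in_vertical_angles _ _ dimV _ (a k) (a (k - 2%:R)) (a (k + 2%:R))).
- exact: aE.
- have [sp ind] := a_frame oim; split=> [x|s t u E].
    by have [s [t [u ->]]] := sp x; exists t, s, u; rewrite (addrC (t *: _)).
  by have [|? ? ?] := ind t s u; first by rewrite (addrC (t *: _)).
- split.
  + apply: phi_side => //; have := a_sideR (k - 1).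
    by have -> : k - 1 + 1 = k by ring.
  + apply: phi_side => //; have := a_sideL (k - 1).
    by have -> : k - 1 - 1 = k - 2%:R by ring.
  + by have := phi_next eL; have -> : k - 1 + 3%:R = k + 2%:R by ring.
- split.
  + apply: phi_side => //; have := a_sideL (k + 1).
    by have -> : k + 1 - 1 = k by ring.
  + by have := phi_prev eR; have -> : k + 1 - 3%:R = k - 2%:R by ring.
  + apply: phi_side => //; have := a_sideR (k + 1).
    by have -> : k + 1 + 1 = k + 2%:R by ring.
Qed.

(** The dual angles are cut out by the product of the values at the two ends of the edge; for a
    functional [F x], [kappaP] turns these values into multiples of [phi (i - 1) x] and
    [phi (i + 1) x]. *)
Lemma dual_angles_region C i c : odd i -> C (i + m%:R) = region (i + m%:R) c ->
  dual_angles C (i + m%:R) = f @` region i (- c * gamma i).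
Proof.
move=> oi CE; have oim : ~~ odd (i + m%:R)%R by rewrite oD oN m_odd oi.
have eL : ~~ odd (i - 1)%R by rewrite oB oi o1.
have eR : ~~ odd (i + 1)%R by rewrite oD oi o1.
rewrite /dual_angles CE /region oi (negPf oim).
rewrite lines_meeting_segment; last by move=> s t; apply: a_free.
rewrite /sang (@image_points _ _ _ _ _ F_full fF _
  (fun chi : 'Hom(V, R^o) =>
     0 <= - c * ((chi (a (i + m%:R - 1)) : R) * chi (a (i + m%:R + 1))))) // => x.
have := kappaP x eL; have -> : i - 1 + m%:R = i + m%:R - 1 by ring.
move=> ->; have := kappaP x eR; have -> : i + 1 + m%:R = i + m%:R + 1 by ring.
by move=> ->; rewrite /gamma mulrACA (mulrA (- c)).
Qed.

Hypothesis f_unique : forall g, self_duality m A g -> g = f.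

Lemma curve_self_dualP C (e : Z -> R) : (forall i, e i != 0) ->
  (forall i, C i = region i (e i)) ->
  curve_self_dual m A C <-> forall i, 0 < e i * (- e (i + m%:R) * gamma i).
Proof.
move=> e0 CE.
have g0 i : - e (i + m%:R) * gamma i != 0.
  by rewrite !mulf_neq0 ?oppr_eq0 ?kappa_neq0.
have f_inj := proj_iso_inj F_inj fF.
have img (X Y : set (projsp V)) : f @` X = f @` Y -> X = Y.
  move=> E; apply/seteqP; split=> p Xp.
    have : (f @` X) (f p) by exists p.
    by rewrite E => -[q Yq /f_inj <-].
  have : (f @` Y) (f p) by exists p.
  by rewrite -E => -[q Yq /f_inj <-].
(* Uniqueness replaces [g] by [f], and injectivity of [f] turns equal images into equal regions,
   hence into a sign condition. *)
split=> [[g [/f_unique -> He Ho]] i|H].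
  apply/(@region_eq i) => //; apply: img; rewrite -CE.
  have [oi|oi] := boolP (odd i).
    by rewrite Ho // (dual_angles_region oi (CE _)).
  by rewrite He // (dual_edge_region oi (CE _)).
exists f; split.
- by split=> //; exists F; rewrite // F_inj F_full eqxx.
- move=> i oi; rewrite (dual_edge_region oi (CE _)) CE.
  by congr (f @` _); apply/region_eq.
- move=> i oi; rewrite (dual_angles_region oi (CE _)) CE.
  by congr (f @` _); apply/region_eq.
Qed.

(** The two products are eigenvalues of one endomorphism [Hk] at the independent vectors [a i] and
    [a (i + 2)], and [Hk] preserves every line. *)
Lemma monodromy k : (n %| m * k)%N ->
  forall i, odd i ->
  \prod_(0 <= u < k) kappa (i + m%:R + (2 * m * u)%:R)
  = \prod_(0 <= u < k) kappa (i + 2%:R + m%:R + (2 * m * u)%:R).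
Proof.
move=> nmk.
have [G GE] := exists_transpose F.
pose H := (F^-1 \o G)%VF.
have HE x : F (H x) = G x.
  by rewrite lfunE /= limg_lfunVK // F_full memvf.
have G0 y : G y = 0 -> y = 0.
  move=> Gy; apply: functional_separates => chi.
  have chiF : (chi : dualsp V) \in limg F by rewrite F_full memvf.
  by rewrite -(limg_lfunVK chiF) -GE Gy lfunE.
have [Hk HkE] := exists_iter_lfun H k.
have H_inj : injective H.
  move=> x y /(congr1 F); rewrite !HE => /eqP.
  by rewrite -subr_eq0 -linearB => /eqP/G0/eqP; rewrite subr_eq0 => /eqP.
have Hk_inj : lker Hk == 0%VS.
  apply/lker0P => x y; rewrite !HkE; elim: (k) => // l IH /= /H_inj.
  exact: IH.
(* Transposition turns [kappaP] at the even index [i + m] into an identity between values of [F], as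
   [phi (i + m)] is [F (a i)]. *)
have Ha i : odd i -> H (a (i + (2 * m)%:R)) = kappa (i + m%:R) *: a i.
  move=> oi; apply: (lker0P F_inj); rewrite HE linearZ /=; apply/lfunP => x.
  have oim : ~~ odd (i + m%:R)%R by rewrite oD oN m_odd oi.
  rewrite GE [RHS]scale_fctE -[i in F (a i)](addrK m%:R) -(kappaP x oim).
  by congr (fun_of_lfun (F x) (a _)); rewrite natrM; ring.
have iterHa l i : odd i -> iter l H (a (i + (2 * m * l)%:R))
    = (\prod_(0 <= u < l) kappa (i + m%:R + (2 * m * u)%:R)) *: a i.
  move=> oi; elim: l => [|l IH]; first by rewrite muln0 addr0 big_nil scale1r.
  rewrite iterSr; have -> : i + (2 * m * l.+1)%:R = i + (2 * m * l)%:R + (2 * m)%:R.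
    by rewrite mulnS natrD addrA addrAC.
  rewrite Ha; last by rewrite oD oN oi -mulnA mul2n odd_double.
  have [Hl HlE] := exists_iter_lfun H l.
  rewrite -HlE linearZ /= HlE IH scalerA big_nat_recr //= mulrC.
  by rewrite (addrAC i).
have mk0 : ((2 * m * k)%:R : Z) = 0.
  by apply/eqP; rewrite natr_Zp_eq0 ?double_gt1 // -mul2n -mulnA dvdn_pmul2l.
have {iterHa}Hka i : odd i ->
    Hk (a i) = (\prod_(0 <= u < k) kappa (i + m%:R + (2 * m * u)%:R)) *: a i.
  by move=> oi; rewrite HkE -iterHa // mk0 addr0.
have FHk0 : lker (F \o Hk)%VF == 0%VS.
  by apply/lker0P => x y; rewrite !lfunE => /(lker0P F_inj)/(lker0P Hk_inj).
have [g gE] := exists_proj_map FHk0.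
(* [Hk] only rescales the vertex vectors, so [F \o Hk] also induces a self-duality. *)
have gf : g = f.
  apply: f_unique; split.
    exists (F \o Hk)%VF; last exact: gE.
    by split=> //; rewrite limg_comp (lker0_limgf Hk_inj) F_full.
  move=> i oi; rewrite -f_dual // gE fF aE !limg_line lfunE /= Hka // linearZ /=.
  rewrite vlineZ //.
  by rewrite prodf_seq_neq0; apply/allP => u _; apply/implyP => _; exact: kappa_neq0.
have Hk_scalar x : exists c, Hk x = c *: x.
  have [->|x0] := eqVneq x 0; first by exists 0; rewrite linear0 scaler0.
  have [p pE] := projsp_line x0.
  have : (F (Hk x) : dualsp V) \in val (f p).
    by rewrite -gf gE pE limg_line lfunE memv_line.
  rewrite fF pE limg_line => /vlineP[c cE]; exists c.
  by apply: (lker0P F_inj); rewrite linearZ.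
move=> i oi; have oi2 : odd (i + 2%:R)%R by rewrite oD oN oi.
have oi1 : ~~ odd (i + 1)%R by rewrite oD o1 oi.
(* The scalar may a priori depend on the vector; the sum of two independent eigenvectors forces
   their eigenvalues to agree. *)
have [c] := Hk_scalar (a i + a (i + 2%:R)).
rewrite linearD /= !Hka //; set mu := \prod_(_ <= _ < _) _.
set mu' := \prod_(_ <= _ < _) _.
move=> E; have [||/eqP + /eqP] := @a_free (i + 1) (mu - c) (mu' - c) => //.
  have -> : i + 1 - 1 = i by ring.
  have -> : i + 1 + 1 = i + 2%:R by ring.
  by rewrite !scalerBl addrACA E -opprD -scalerDr subrr.
by rewrite !subr_eq0 => /eqP -> /eqP ->.
Qed.

(** * Products around closed cycles of indices *)

Section Monodromy.
Variable k : nat.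
Hypothesis n_dvd_mk : (n %| m * k)%N.

(** Half of the [2 * k] indices are odd and contribute the dummy factor [1]; keeping them makes
    translation by [m] a mere cyclic shift of the factors. *)
Let kappa_cycle i := \prod_(0 <= u < 2 * k) kappa (i + (m * u)%:R).

Let kappa_cycle_neq0 i : kappa_cycle i != 0.
Proof. by rewrite prodf_seq_neq0; apply/allP => u _; exact: kappa_neq0. Qed.

Let kappa_cycle_odd i : odd i ->
  kappa_cycle i = \prod_(0 <= u < k) kappa (i + m%:R + (2 * m * u)%:R).
Proof.
move=> oi; rewrite /kappa_cycle; elim: (k) => [|l IH].
  by rewrite muln0 !big_nil.
rewrite mulnS !big_nat_recr //= IH -mulrA; congr (_ * _).
rewrite {1}/kappa oD oN oi oddM mul2n odd_double andbF mul1r.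
by congr kappa; rewrite -addrA -natrD mulnS -[l.*2]mul2n mulnCA mulnA.
Qed.

Let kappa_cycle_shift i : kappa_cycle (i + m%:R) = kappa_cycle i.
Proof.
pose h u := kappa (i + (m * u)%:R).
have -> : kappa_cycle (i + m%:R) = \prod_(0 <= u < 2 * k) h u.+1.
  by apply: eq_bigr => u _; rewrite /h mulnS natrD addrA.
have h0 : h 0 != 0 by exact: kappa_neq0.
apply: (mulfI h0); rewrite -big_nat_recl // big_nat_recr //= mulrC; congr (_ * _).
rewrite /h; congr (kappa (i + _)); rewrite muln0.
by apply/eqP; rewrite natr_Zp_eq0 ?double_gt1 // -mul2n mulnCA dvdn_pmul2l.
Qed.

(** Odd indices are covered by [monodromy]; an even one becomes odd after translation by [m]. *)
Let kappa_cycle_add2 i : kappa_cycle (i + 2%:R) = kappa_cycle i.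
Proof.
have odd_case j : odd j -> kappa_cycle (j + 2%:R) = kappa_cycle j.
  move=> oj; rewrite !kappa_cycle_odd ?oD ?oN ?oj //.
  exact/esym/monodromy.
have [/odd_case//|oi] := boolP (odd i).
rewrite -(kappa_cycle_shift i) -(kappa_cycle_shift (i + 2%:R)) addrAC.
by apply: odd_case; rewrite oD oN m_odd (negPf oi).
Qed.

(** The [2 * k] minus signs cancel, and the two cycles of [kappa], based at [i - 1] and [i + 1],
    have equal products, leaving a nonzero square. *)
Lemma prod_gamma_gt0 i : 0 < \prod_(0 <= u < 2 * k) - gamma (i + (m * u)%:R).
Proof.
rewrite (eq_bigr (fun u => -1 * gamma (i + (m * u)%:R))); last first.
  by move=> u _; rewrite mulN1r.
rewrite big_split /= prodr_const_nat subn0 exprM sqrrN !expr1n mul1r.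
rewrite (eq_bigr (fun u =>
  kappa (i - 1 + (m * u)%:R) * kappa (i + 1 + (m * u)%:R))); last first.
  by move=> u _; rewrite /gamma (addrAC i (-1)) (addrAC i 1).
rewrite big_split /= -/(kappa_cycle _) -/(kappa_cycle _).
have -> : i + 1 = i - 1 + 2%:R by ring.
by rewrite kappa_cycle_add2 -expr2 exprn_even_gt0 //= kappa_cycle_neq0.
Qed.

End Monodromy.

Lemma gamma_neq0 i : gamma i != 0.
Proof. by rewrite mulf_neq0 ?kappa_neq0. Qed.

End SelfDualPolygon.

(** * Signs as bits, and the final count *)

Lemma prod_lt0_addb (R : realDomainType) (g : nat -> R) k :
  (forall u, g u != 0) ->
  (\prod_(0 <= u < k) g u < 0) = \big[addb/false]_(0 <= u < k) (g u < 0).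
Proof.
move=> g0; elim: k => [|k IH]; first by rewrite !big_nil ltr10.
rewrite !big_nat_recr //= -IH; set P := \prod_(_ <= _ < _) _.
have P0 : P != 0 by rewrite prodf_seq_neq0; apply/allP => u _; exact: g0.
have [Pn|Pp|E] := ltgtP P 0; last by rewrite E eqxx in P0.
  by rewrite nmulr_rlt0 //; case: ltgtP (g0 k).
by rewrite pmulr_rlt0.
Qed.

Lemma sign_mul_gt0 (R : realDomainType) (b : bool) (g : R) : g != 0 ->
  (0 < (-1) ^+ b * g) = (b == (g < 0)).
Proof.
move=> g0; case: b => /=; first by rewrite expr1 mulN1r oppr_gt0 eq_sym eqb_id.
by rewrite expr0 mul1r eq_sym eqbF_neg -leNgt lt_neqAle eq_sym g0.
Qed.

Theorem proposition14 (R : realType) (n m : nat)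
    (A : 'Z_(n.*2) -> projsp 'rV[R]_3)
    (m_odd : odd m) (m_ge1 : (1 <= m)%N) (m_le_n : (m <= n)%N)
    (A_nondeg : nondegenerate_polygon A)
    (A_self_dual : polygon_self_dual m A)
    (A_unique : forall f g : projsp 'rV[R]_3 -> projsp (dualsp 'rV[R]_3),
       self_duality m A f -> self_duality m A g -> f = g) :
  ([set C | polygonal_curve A C] #= `I_(2 ^ (2 * n))%N) /\
  ([set C | polygonal_curve A C /\ curve_self_dual m A C]
     #= `I_(2 ^ gcdn m n)%N).
Proof.
have n_gt0 : (0 < n)%N := leq_trans m_ge1 m_le_n.
have [f fP] := A_self_dual.
have [[F [F_inj /eqP F_full] fF] f_dual] := fP.
have f_unique g : self_duality m A g -> g = f by move=> gP; exact: A_unique.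
pose reg := region m A F; pose g := gamma m A F.
pose curve (e : {ffun 'Z_(n.*2) -> bool}) i := reg i ((-1) ^+ e i).
have sgn0 (b : bool) : (-1) ^+ b != 0 :> R by rewrite signr_eq0.
have reg_eq i c c' : c != 0 -> c' != 0 -> reg i c = reg i c' <-> 0 < c * c'.
  exact: (region_eq n_gt0 m_odd A_nondeg F_inj fF f_dual).
have curve_inj : injective curve.
  move=> e e' E; apply/ffunP => i; have /reg_eq := congr1 (@^~ i) E.
  by rewrite !sgn0 sign_mul_gt0 // signr_lt0 => /(_ isT isT)/eqP.
have curveP C : polygonal_curve A C <-> exists e, C = curve e.
  rewrite (polygonal_curveP n_gt0 m_odd A_nondeg F_inj fF f_dual).
  split=> [H|[e ->] i]; last by exists ((-1) ^+ e i).
  (* A region with nonzero coefficient is that of [1] or of [-1], so comparison with the latter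
     determines the bit. *)
  exists [ffun i => `[< C i = reg i (-1) >]]; apply/funext => i.
  rewrite /curve ffunE; case: asboolP => [->|CN]; first by rewrite expr1.
  have [c c0 Cc] := H i; rewrite expr0 Cc; apply/reg_eq => //; rewrite ?oner_eq0 //.
  rewrite mulr1 lt_neqAle eq_sym c0 leNgt; apply/negP => cn; apply: CN.
  by rewrite Cc; apply/reg_eq; rewrite ?oppr_eq0 ?oner_eq0 // mulrN1 oppr_gt0.
(* In terms of sign bits, the self-duality inequality reads [e (i + m) = e i (+) s i]. *)
pose s i := - g i < 0.
have g0 i : - g i != 0.
  by rewrite oppr_eq0 (gamma_neq0 n_gt0 m_odd A_nondeg F_inj F_full fF f_dual).
have selfP e : curve_self_dual m A (curve e) <->
    [forall i, e (i + m%:R) == e i (+) s i].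
  rewrite (curve_self_dualP n_gt0 m_odd A_nondeg F_inj F_full fF f_dual f_unique
    (e := fun i => (-1) ^+ e i)) //.
  have E i : (0 < (-1) ^+ e i * (- (-1) ^+ e (i + m%:R) * g i)) =
      (e (i + m%:R) == e i (+) s i).
    rewrite mulNr -mulrN mulrA -signr_addb sign_mul_gt0 // -/(s i).
    by move: (e i) (e (i + m%:R)) (s i) => [] [] [].
  by split=> [H|/forallP H i]; [apply/forallP => i|]; rewrite -?E // E.
split.
  rewrite (_ : [set C | _] = [set C | exists2 e,
      e \in [set: {ffun 'Z_(n.*2) -> bool}]%SET & C = curve e]).
    have -> : (2 ^ (2 * n))%N = #|[set: {ffun 'Z_(n.*2) -> bool}]%SET|.
      by rewrite cardsT card_ffun card_bool card_ord Zp_cast ?double_gt1 // mul2n.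
    exact: (card_eq_finset_image _ curve_inj).
  apply/seteqP; split=> C; first by case/curveP=> e ->; exists e => //; rewrite inE.
  by case=> e _ ->; apply/curveP; exists e.
pose X := [set e : {ffun 'Z_(n.*2) -> bool} |
  [forall i, e (i + m%:R) == e i (+) s i]]%SET.
rewrite (_ : [set C | _] = [set C | exists2 e, e \in X & C = curve e]); last first.
  apply/seteqP; split=> C.
    by case=> /curveP[e ->] /selfP H; exists e => //; rewrite inE.
  case=> e; rewrite inE => H ->; split; first by apply/curveP; exists e.
  exact/selfP.
have N_gt1 := double_gt1 n_gt0.
have gcd_double : gcdn m n.*2 = gcdn m n.
  by rewrite -mul2n Gauss_gcdr // coprimen2.
suff -> : (2 ^ gcdn m n)%N = #|X| by exact: (card_eq_finset_image _ curve_inj).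
rewrite -gcd_double -(fcard_shift m N_gt1); apply/esym/card_cyclic_equations => [|i].
  exact: shift_inj.
rewrite order_shift // gcd_double.
have d_gt0 : (0 < gcdn m n)%N by rewrite gcdn_gt0 m_ge1.
have -> : (n.*2 %/ gcdn m n = 2 * (n %/ gcdn m n))%N.
  by rewrite -mul2n muln_divA ?dvdn_gcdr.
(* Each orbit has length [2 * k] with [k = n / gcdn m n], and [m * k] is [m / gcdn m n] times
   [n]. *)
have nmk : (n %| m * (n %/ gcdn m n))%N.
  by rewrite muln_divA ?dvdn_gcdr // mulnC -muln_divA ?dvdn_gcdl // dvdn_mulr.
rewrite (eq_bigr (fun u => - g (i + (m * u)%:R) < 0)); last first.
  by move=> u _; rewrite iter_shift.
(* The sum of the bits around an orbit is the sign bit of the product of the [- g], which is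
   positive. *)
rewrite -prod_lt0_addb //; apply/negbTE; rewrite -leNgt ltW //.
exact: (prod_gamma_gt0 n_gt0 m_odd A_nondeg F_inj F_full fF f_dual f_unique).
Qed.
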